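(* Let $d\ge 1$. For every symmetric convex body $K\subseteq\mathbb{R}^d$, $$f(K)\geq \frac{2}{3^d+2^d}.$$ Equivalently, every finite collection $\mathcal{C}$ of translates of $K$ contains a pairwise disjoint subcollection $\mathcal{S}$ such that $$\operatorname{vol}\left(\bigcup_{K'\in\mathcal S}K'\right)\geq\frac{2}{3^d+2^d}\operatorname{vol}\left(\bigcup_{K'\in\mathcal{C}}K'\right).$$
   Context: A convex body in $\mathbb{R}^d$ is a compact convex set with nonempty interior; it is symmetric if $K=-K$. A translate of $K$ is a set $K+x=\{y+x:y\in K\}$ with $x\in\mathbb{R}^d$. $\operatorname{vol}$ denotes $d$-dimensional Lebesgue measure. For a convex body $K$, $f(K)$ denotes the largest constant $c\ge 0$ such that every finite collection $\mathcal{C}$ of translates of $K$ admits a pairwise disjoint subcollection $\mathcal{S}\subseteq\mathcal{C}$ satisfying $\operatorname{vol}\left(\bigcup_{K'\in\mathcal S}K'\right)\geq c\operatorname{vol}\left(\bigcup_{K'\in\mathcal{C}}K'\right)$. Two translates that meet only at boundary points count as intersecting (not disjoint). *)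

(* Defs.v *)
From HB Require Import structures.
From mathcomp Require Import all_boot all_order all_algebra.
From mathcomp Require Import all_classical all_reals all_analysis.
Import numFieldNormedType.Exports.

Set Implicit Arguments.
Unset Strict Implicit.
Unset Printing Implicit Defensive.

Import Order.TTheory GRing.Theory Num.Theory.

Local Open Scope classical_set_scope.
Local Open Scope ring_scope.

Section Defs.
Variables (R : realType) (d : nat).
Local Notation V := 'rV[R]_d.

Definition box (a b : V) : set V :=
  [set x | forall i, a ord0 i <= x ord0 i <= b ord0 i].

Definition box_vol (a b : V) : R :=
  \prod_(i < d) Num.max 0 (b ord0 i - a ord0 i).

(* Lebesgue outer measure on R^d; the theorem only applies it to finite unions
   of compact sets, where it agrees with d-dimensional Lebesgue measure. *)
Definition vol (A : set V) : \bar R :=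
  ereal_inf [set (\sum_(0 <= k <oo) (box_vol (ab k).1 (ab k).2)%:E)%E |
             ab in [set ab : nat -> V * V |
                    A `<=` \bigcup_k box (ab k).1 (ab k).2]].

Definition convex_body (K : set V) : Prop :=
  [/\ compact K, convex_set K & interior K !=set0].

Definition symmetric_set (K : set V) : Prop := K = [set - x | x in K].

Definition translate (K : set V) (x : V) : set V := [set y + x | y in K].

Definition finite_translates (K : set V) (C : set (set V)) : Prop :=
  finite_set C /\ C `<=` range (translate K).

(* The empty intersection is set-theoretic, so translates that merely touch
   along their boundaries are not disjoint. *)
Definition disjoint_subcollection (S C : set (set V)) : Prop :=
  S `<=` C /\ trivIset S id.

Definition admissible_constant (K : set V) (c : R) : Prop :=
  0 <= c /\
  forall C, finite_translates K C ->
    exists2 S, disjoint_subcollection S C &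
      (c%:E * vol (\bigcup_(A in C) A) <= vol (\bigcup_(A in S) A))%E.

(* The largest admissible constant, as a supremum in the extended reals: it is
   thus meaningful without first showing that the constants are bounded. *)
Definition fconst (K : set V) : \bar R :=
  ereal_sup [set c%:E | c in admissible_constant K].

End Defs.

(* Main.v *)
Require Import Defs.
From HB Require Import structures.
From mathcomp Require Import all_boot all_order all_algebra.
From mathcomp Require Import finmap.
From mathcomp Require Import all_classical all_reals all_analysis.
From mathcomp Require Import zify ring lra.
Import numFieldNormedType.Exports.

Set Implicit Arguments.
Unset Strict Implicit.
Unset Printing Implicit Defensive.

Import Order.TTheory GRing.Theory Num.Theory.

Local Open Scope classical_set_scope.
Local Open Scope ring_scope.

(** Choose a pairwise disjoint subcollection [S] with as many members as
possible. Every translate of the collection meets a member of [S]. Two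
translates that both meet [s + K] but no other member of [S] must meet each
other, since otherwise replacing [s + K] by both would enlarge [S]; hence the
union [P s] of these private translates has its difference set in [4 K], and
Brunn-Minkowski gives [vol (P s) <= 2^d vol K]. Each point of the whole union
lies either in two of the sets [s + 3 K], of volume [3^d vol K] each, or in one
of them and in the corresponding [P s]. So twice the volume of the union is at
most [(3^d + 2^d) vol K] times the number of members of [S].

All volumes are estimated by counting points of a fine lattice, and all bodies
are inflated by a factor [t] that finally tends to [1]. On the lattice,
Brunn-Minkowski follows from a discrete Prekopa-Leindler inequality. *)

(** * A discrete Prekopa-Leindler inequality *)

(** Lists rather than functions on ['I_d], so that induction on the dimension peels off the head
    coordinate. *)
Fixpoint grid (N d : nat) : seq (seq nat) :=
  if d is d'.+1 then [seq i :: s | i <- iota 0 N, s <- grid N d'] else [:: [::]].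

Lemma mem_grid (N d : nat) (s : seq nat) :
  (s \in grid N d) = (size s == d) && all (fun i => i < N)%N s.
Proof.
elim: d s => [|d IHd] [|i s] //=; first by apply/allpairsP; case=> -[? ?] [].
apply/allpairsP/idP => /=.
  case=> -[j t] /= [jN tG [-> ->]]; move: tG; rewrite IHd => /andP[/eqP -> ->].
  by move: jN; rewrite mem_iota /= add0n eqxx => ->.
rewrite eqSS => /and3P[sd iN sN]; exists (i, s); split=> //=.
  by rewrite mem_iota.
by rewrite IHd sd sN.
Qed.

Lemma sum_gridS (V : nmodType) (N d : nat) (F : seq nat -> V) :
  \sum_(s <- grid N d.+1) F s = \sum_(0 <= i < N) \sum_(s <- grid N d) F (i :: s).
Proof. by rewrite /= big_allpairs_dep /index_iota subn0. Qed.

Lemma sum_grid_rev (V : nmodType) (N d : nat) (F : seq nat -> V) :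
  \sum_(s <- grid N d) F [seq N.-1 - i | i <- s]%N = \sum_(s <- grid N d) F s.
Proof.
elim: d F => [|d IHd] F; first by rewrite !big_seq1.
rewrite !sum_gridS big_nat_rev; apply: eq_big_nat => i iN.
rewrite -[RHS]IHd; apply: eq_bigr => s _ /=; congr (F (_ :: _)); lia.
Qed.

Lemma sum_grid_prod (R : comRingType) (N d : nat) (F : nat -> nat -> R) :
  \sum_(s <- grid N d) \prod_(i < d) F i (nth 0%N s i) =
  \prod_(i < d) \sum_(0 <= k < N) F i k.
Proof.
elim: d F => [|d IHd] F; first by rewrite big_seq1 !big_ord0.
rewrite sum_gridS big_ord_recl -(IHd (fun i => F i.+1)) big_distrl /=.
by apply: eq_bigr => i _; rewrite big_distrr; apply: eq_bigr => s _; rewrite big_ord_recl.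
Qed.

(** The slack of one per coordinate enlarges a sumset by the cube [{0,1}^d]. Intervals of [m] and
    [n] integers then yield [m + n] integers instead of [m + n - 1], so no lower-order loss enters
    the inequality. *)
Fixpoint near_sum (x y w : seq nat) : bool :=
  match x, y, w with
  | [::], [::], [::] => true
  | a :: x', b :: y', c :: w' => (a + b <= c <= (a + b).+1)%N && near_sum x' y' w'
  | _, _, _ => false
  end.

Lemma near_sum_nth (x y w : seq nat) (i : nat) : near_sum x y w ->
  (nth 0 x i + nth 0 y i <= nth 0 w i <= (nth 0 x i + nth 0 y i).+1)%N.
Proof.
by elim: x y w i => [|a x IHx] [|b y] [|c w] [|i] //= /andP[// _ /IHx].
Qed.

(* Walking down from [(m, n)] to [(0, 0)], decrease the coordinate carrying the
   smaller value; that value is charged to the current index of [w]. *)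
Lemma sum_le_of_min_le (R : realDomainType) (u v w : nat -> R) (m n : nat) :
  u 0%N = v 0%N ->
  (forall i, (i <= m)%N -> u i <= u 0%N) -> (forall j, (j <= n)%N -> v j <= v 0%N) ->
  (forall i j, (i <= m)%N -> (j <= n)%N -> Num.min (u i) (v j) <= w (i + j)%N) ->
  \sum_(1 <= i < m.+1) u i + \sum_(1 <= j < n.+1) v j <= \sum_(1 <= k < (m + n).+1) w k.
Proof.
move=> uv0; have [k] : exists k, (m + n <= k)%N by exists (m + n)%N.
elim: k m n => [|k IHk] m n mnk um vn uvw.
  have [-> ->] : m = 0%N /\ n = 0%N by lia.
  by rewrite !big_geq ?addr0.
have stepm : (0 < m)%N -> u m <= v n ->
    \sum_(1 <= i < m.+1) u i + \sum_(1 <= j < n.+1) v j <= \sum_(1 <= k < (m + n).+1) w k.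
  case: m mnk um uvw => // m mnk um uvw _ le_uv.
  rewrite addSn big_nat_recr //= [leRHS]big_nat_recr //= addrAC lerD //.
    by apply: IHk => [|i im|//|i j im jn]; [lia|apply: um; lia|apply: uvw; lia].
  by have := uvw m.+1 n (leqnn _) (leqnn _); rewrite min_l // addSn.
have stepn : (0 < n)%N -> v n <= u m ->
    \sum_(1 <= i < m.+1) u i + \sum_(1 <= j < n.+1) v j <= \sum_(1 <= k < (m + n).+1) w k.
  case: n mnk vn uvw {stepm} => // n mnk vn uvw _ le_vu.
  rewrite addnS [X in _ + X <= _]big_nat_recr //= [leRHS]big_nat_recr //= addrA lerD //.
    by apply: IHk => [|//|i im|i j im jn]; [lia|apply: vn; lia|apply: uvw; lia].
  by have := uvw m n.+1 (leqnn _) (leqnn _); rewrite min_r // addnS.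
have [m0|m0] := posnP m; have [n0|n0] := posnP n.
- by rewrite m0 n0 !big_geq ?addr0.
- by apply: stepn => //; rewrite m0 uv0; apply: vn.
- by apply: stepm => //; rewrite n0 -uv0; apply: um.
- by have [?|?] := leP (u m) (v n); [apply: stepm|apply: stepn => //; exact: ltW].
Qed.

Lemma sum_nat_around (V : nmodType) (F : nat -> V) (a N : nat) : (a < N)%N ->
  \sum_(0 <= i < N) F i =
  \sum_(1 <= i < a.+1) F (a - i)%N + (F a + \sum_(1 <= i < (N.-1 - a).+1) F (a + i)%N).
Proof.
move=> aN; rewrite (@big_cat_nat _ _ _ a) //=; last exact: ltnW.
congr (_ + _).
  rewrite big_nat_rev /= big_add1 /=; apply: eq_big_nat => i ia; congr F; lia.
rewrite big_ltn //; congr (_ + _).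
rewrite -{1}[a.+1]addn1 addnC big_addn; have -> : (N - a)%N = (N.-1 - a).+1 by lia.
by apply: eq_bigr => i _; rewrite addnC.
Qed.

(** Both functions are cut at their common maximum value, and left arms and right arms are compared
    separately. The two peaks are charged to [h (a + b)] and [h (a + b + 1)]; the slack of one in
    [k] lets the right arms be shifted past the second of these. *)
Lemma sum_add_le_of_min_le (R : realDomainType) (f g h : nat -> R) (N a b : nat) :
  (a < N)%N -> (b < N)%N -> f a = g b ->
  (forall i, (i < N)%N -> f i <= f a) -> (forall j, (j < N)%N -> g j <= g b) ->
  (forall i j k, (i < N)%N -> (j < N)%N -> (i + j <= k <= (i + j).+1)%N ->
     Num.min (f i) (g j) <= h k) ->
  \sum_(0 <= i < N) f i + \sum_(0 <= j < N) g j <= \sum_(0 <= k < N.*2) h k.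
Proof.
move=> aN bN fagb fa gb fgh.
rewrite (sum_nat_around _ aN) (sum_nat_around _ bN) (@sum_nat_around _ _ (a + b)); last lia.
have -> : (N.*2.-1 - (a + b) = (N.-1 - a + (N.-1 - b)).+1)%N by lia.
set m := (N.-1 - a + (N.-1 - b))%N; have -> : \sum_(1 <= i < m.+2) h (a + b + i)%N =
    h (a + b + 1)%N + \sum_(1 <= k < m.+1) h (a + b + k.+1)%N.
  by rewrite big_ltn // big_add1.
have left_le := @sum_le_of_min_le _ (fun i => f (a - i)%N) (fun i => g (b - i)%N)
  (fun i => h (a + b - i)%N) a b.
have right_le := @sum_le_of_min_le _ (fun i => f (a + i)%N) (fun i => g (b + i)%N)
  (fun i => h (a + b + i.+1)%N) (N.-1 - a) (N.-1 - b).
have h0 : f a <= h (a + b)%N.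
  by have := @fgh a b (a + b)%N aN bN; rewrite fagb minxx; apply; lia.
have h1 : g b <= h (a + b + 1)%N.
  by have := @fgh a b (a + b + 1)%N aN bN; rewrite fagb minxx; apply; lia.
have {}left_le := left_le ltac:(by rewrite !subn0)
  ltac:(move=> i ia; rewrite subn0; apply: fa; lia)
  ltac:(move=> i ia; rewrite subn0; apply: gb; lia)
  ltac:(move=> i j ia jb; apply: fgh; lia).
have {}right_le := right_le ltac:(by rewrite !addn0)
  ltac:(move=> i ia; rewrite addn0; apply: fa; lia)
  ltac:(move=> i ia; rewrite addn0; apply: gb; lia)
  ltac:(move=> i j ia jb; apply: fgh; lia).
rewrite /= -/m in left_le right_le.
lra.
Qed.

Lemma exists_max_nat (R : realDomainType) (f : nat -> R) (N : nat) : (0 < N)%N ->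
  exists2 a, (a < N)%N & forall i, (i < N)%N -> f i <= f a.
Proof.
case: N => // N _; elim: N => [|N [a aN fa]]; first by exists 0%N => // -[].
have [faN|Nfa] := leP (f a) (f N.+1).
  exists N.+1 => // i; rewrite ltnS leq_eqVlt => /predU1P[->//|iN].
  exact: le_trans (fa i iN) faN.
exists a; first exact: ltnW.
by move=> i; rewrite ltnS leq_eqVlt => /predU1P[->|/fa//]; exact: ltW.
Qed.

(** After division by their maxima, [f] and [g] both peak at [1], and the bound on products yields
    one on minima. The sums then add, and AM-GM turns their sum into a product. *)
Lemma discrete_prekopa_leindler1 (R : rcfType) (f g h : nat -> R) (N : nat) :
  (forall i, 0 <= f i) -> (forall i, 0 <= g i) -> (forall i, 0 <= h i) ->
  (forall i j k, (i < N)%N -> (j < N)%N -> (i + j <= k <= (i + j).+1)%N ->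
     f i * g j <= h k ^+ 2) ->
  4 * ((\sum_(0 <= i < N) f i) * \sum_(0 <= j < N) g j) <= (\sum_(0 <= k < N.*2) h k) ^+ 2.
Proof.
move=> f0 g0 h0 fgh.
have [->|N0] := posnP N; first by rewrite !big_geq // mul0r mulr0 expr2 mulr0.
have [a aN fa] := exists_max_nat f N0; have [b bN gb] := exists_max_nat g N0.
have zero (u : nat -> R) c : (forall i, 0 <= u i) -> (forall i, (i < N)%N -> u i <= u c) ->
    u c = 0 -> \sum_(0 <= i < N) u i = 0.
  move=> u0 uc uc0; rewrite big_nat big1 // => i /uc; rewrite uc0 => ui.
  by apply/eqP; rewrite eq_le ui u0.
have [fa0|fa0] := eqVneq (f a) 0; first by rewrite (zero f a) // mul0r mulr0 sqr_ge0.
have [gb0|gb0] := eqVneq (g b) 0; first by rewrite (zero g b) // !mulr0 sqr_ge0.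
have {}fa0 : 0 < f a by rewrite lt_def fa0 f0.
have {}gb0 : 0 < g b by rewrite lt_def gb0 g0.
pose r := Num.sqrt (f a * g b).
have r0 : 0 < r by rewrite sqrtr_gt0 mulr_gt0.
have r2 : r ^+ 2 = f a * g b by rewrite sqr_sqrtr // mulr_ge0.
have := @sum_add_le_of_min_le _ (fun i => f i / f a) (fun i => g i / g b)
  (fun i => h i / r) N a b aN bN.
rewrite !divff ?gt_eqF // -!mulr_suml => /(_ erefl)/=.
set F := \sum_(_ <= _ < N) f _; set G := \sum_(_ <= _ < N) g _; set H := \sum_(_ <= _ < _) h _.
have F0 : 0 <= F by apply: sumr_ge0.
have G0 : 0 <= G by apply: sumr_ge0.
have H0 : 0 <= H by apply: sumr_ge0.
move=> /(_ _ _ _)/wrap[||i j k iN jN ijk|FGH].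
- by move=> i /fa; rewrite ler_pdivrMr // mul1r.
- by move=> i /gb; rewrite ler_pdivrMr // mul1r.
- set p := f i / f a; set q := g j / g b.
  have p0 : 0 <= p by rewrite divr_ge0 ?f0.
  have q0 : 0 <= q by rewrite divr_ge0 ?g0.
  have pq : p * q <= (h k / r) ^+ 2.
    rewrite expr_div_n r2 ler_pdivlMr ?mulr_gt0 // (_ : p * q * (f a * g b) = f i * g j) ?fgh //.
    by rewrite /p /q; field; rewrite !gt_eqF.
  (* The square of [Num.min p q] is at most [p * q]. *)
  rewrite -(@ler_pXn2r _ 2) ?nnegrE ?divr_ge0 ?le_min ?p0 ?(ltW r0) //.
  apply: le_trans pq; rewrite expr2 ler_pM ?le_min ?p0 ?q0 ?ge_min ?lexx ?orbT //.
have -> : 4 * (F * G) = r ^+ 2 * (4 * ((F / f a) * (G / g b))).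
  by rewrite r2; field; rewrite !gt_eqF.
have -> : H ^+ 2 = r ^+ 2 * (H / r) ^+ 2 by rewrite expr_div_n mulrC divfK // gt_eqF ?exprn_gt0.
rewrite ler_pM2l ?exprn_gt0 //.
have p0 : 0 <= F / f a by rewrite divr_ge0 // ltW.
have q0 : 0 <= G / g b by rewrite divr_ge0 // ltW.
apply: (@le_trans _ _ ((F / f a + G / g b) ^+ 2)).
  by rewrite -subr_ge0 (_ : _ - _ = (F / f a - G / g b) ^+ 2) ?sqr_ge0 //; ring.
by rewrite ler_pXn2r // nnegrE ?addr_ge0 // (le_trans _ FGH) ?addr_ge0.
Qed.

(** Induction on [d]: by the inductive hypothesis, the sums over slices with fixed first coordinate
    satisfy the one-dimensional hypothesis. *)
Lemma discrete_prekopa_leindler (R : rcfType) (N d : nat) (f g h : seq nat -> R) :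
  (forall s, 0 <= f s) -> (forall s, 0 <= g s) -> (forall s, 0 <= h s) ->
  (forall x y w, x \in grid N d -> y \in grid N d -> near_sum x y w ->
     f x * g y <= h w ^+ 2) ->
  4 ^+ d * ((\sum_(s <- grid N d) f s) * \sum_(s <- grid N d) g s)
    <= (\sum_(s <- grid N.*2 d) h s) ^+ 2.
Proof.
elim: d f g h => [|d IHd] f g h f0 g0 h0 fgh.
  by rewrite !big_seq1 expr0 mul1r; apply: fgh; rewrite // inE.
(* The slice sums of [f] and [g] each carry a factor [2 ^+ d], whose product is the [4 ^+ d] of the
   inductive hypothesis. *)
have := @discrete_prekopa_leindler1 R (fun i => 2 ^+ d * \sum_(s <- grid N d) f (i :: s))
  (fun i => 2 ^+ d * \sum_(s <- grid N d) g (i :: s))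
  (fun i => \sum_(s <- grid N.*2 d) h (i :: s)) N.
have p2 : 0 <= 2 ^+ d :> R by rewrite exprn_ge0.
have e4 : 4 ^+ d = 2 ^+ d * 2 ^+ d :> R by rewrite -exprMn -natrM.
rewrite -!mulr_sumr -!sum_gridS => /(_ _ _ _ _)/wrap[i|i|i|i j k iN jN ijk|].
- by rewrite mulr_ge0 // sumr_ge0.
- by rewrite mulr_ge0 // sumr_ge0.
- by rewrite sumr_ge0.
- rewrite mulrACA -e4; apply: IHd => // x y w xG yG xyw; apply: fgh; last by rewrite /= ijk.
    by move: xG; rewrite !mem_grid /= iN eqSS.
  by move: yG; rewrite !mem_grid /= jN eqSS.
by apply: le_trans; rewrite le_eqVlt exprS e4; apply/orP; left; apply/eqP; ring.
Qed.

(** * Volume and lattice point counts *)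

(** As a function of [x] the product is a polynomial with nonnegative coefficients, hence convex on
    [[0, 1]] and below its chord. *)
Lemma prod_addr_le (R : realDomainType) (I : Type) (r : seq I) (c : I -> R) (x : R) :
  (forall i, 0 <= c i) -> 0 <= x <= 1 ->
  \prod_(i <- r) (c i + x)
    <= \prod_(i <- r) c i + x * (\prod_(i <- r) (c i + 1) - \prod_(i <- r) c i).
Proof.
move=> c0 /andP[x0 x1].
elim: r => [|i r IHr]; first by rewrite !big_nil subrr mulr0 addr0.
rewrite !big_cons; set P := \prod_(j <- r) c j in IHr *.
set Q := \prod_(j <- r) (c j + 1) in IHr *.
have PQ : 0 <= Q - P by rewrite subr_ge0; apply: ler_prod => j _; rewrite c0 lerDl ler01.
apply: (le_trans (ler_wpM2l _ IHr)); first by rewrite addr_ge0.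
rewrite -subr_ge0 [leRHS](_ : _ = x * (1 - x) * (Q - P)); last by ring.
by rewrite mulr_ge0 // mulr_ge0 // subr_ge0.
Qed.

Lemma exists_prod_addr_le (R : realFieldType) (I : Type) (r : seq I) (c : I -> R) (e : R) :
  (forall i, 0 <= c i) -> 0 < e ->
  exists2 x, 0 < x <= 1 & \prod_(i <- r) (c i + x) <= \prod_(i <- r) c i + e.
Proof.
move=> c0 e0; set M := \prod_(i <- r) (c i + 1) - \prod_(i <- r) c i.
have M0 : 0 <= M by rewrite subr_ge0; apply: ler_prod => j _; rewrite c0 lerDl ler01.
have M1 : 0 < M + 1 by rewrite ltr_wpDl.
exists (Num.min 1 (e / (M + 1))); first by rewrite lt_min ltr01 divr_gt0 // ge_min lexx.
set x := Num.min _ _.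
have x0 : 0 <= x by rewrite le_min ler01 ltW // divr_gt0.
apply: le_trans (prod_addr_le _ c0 _) _; first by rewrite x0 ge_min lexx.
rewrite lerD2l -/M.
have xe : x * (M + 1) <= e by rewrite -ler_pdivlMr // ge_min lexx orbT.
by apply: le_trans xe; rewrite ler_wpM2l // lerDl.
Qed.

(** Removes the inflation factor by letting [t] tend to [1]. *)
Lemma le_of_le_exprn_mul (R : realFieldType) (a b : R) (d : nat) : 0 <= b ->
  (forall t, 1 < t -> a <= t ^+ d * b) -> a <= b.
Proof.
move=> b0 ab; apply/ler_addgt0Pr => e e0.
have b1 : 0 < b + 1 by rewrite ltr_wpDl.
have [x /andP[x0 _]] := @exists_prod_addr_le R _ (iota 0 d) (fun=> 1) (e / (b + 1))
  (fun=> ler01) (divr_gt0 e0 b1).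
rewrite !big_const_seq !count_predT size_iota !iter_mulr_1 expr1n => xe.
have /ab/le_trans : 1 < 1 + x by rewrite ltrDl.
apply; apply: le_trans (ler_wpM2r b0 xe) _.
by rewrite mulrDl mul1r lerD2l mulrAC ler_pdivrMr // ler_pM2l // lerDl.
Qed.

(** A point of a lattice of mesh [1 / n]; the offset [o] lets a grid of natural numbers reach
    negative coordinates. *)
Definition lattice_pt (R : fieldType) (d n : nat) (o : R) (s : seq nat) : 'rV[R]_d :=
  \row_(i < d) ((nth 0%N s i)%:R / n%:R - o).

Definition lattice_count (R : fieldType) (d n : nat) (o : R) (N : nat) (A : set 'rV[R]_d) : R :=
  \sum_(s <- grid N d) \1_A (lattice_pt d n o s).

Lemma sum_nat_itv_le (R : realDomainType) (a b : R) (N : nat) : a <= b + 1 ->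
  \sum_(0 <= k < N) (a <= k%:R <= b)%R%:R <= b - a + 1.
Proof.
(* Cutting the interval off at [N] as well makes the bound inductive. *)
move=> ab; suff : \sum_(0 <= k < N) (a <= k%:R <= b)%R%:R
    <= Num.max 0 (Num.min N%:R (b + 1) - a).
  move=> /le_trans; apply; rewrite ge_max; apply/andP; split; first lra.
  have : Num.min N%:R (b + 1) <= b + 1 by rewrite ge_min lexx orbT.
  lra.
elim: N => [|N IHN]; first by rewrite big_geq // le_max lexx.
rewrite big_nat_recr //= -[N.+1%:R]natr1.
have [/andP[aN Nb]|_] := boolP (a <= N%:R <= b).
  move: IHN; rewrite (min_l (_ : N%:R <= b + 1)); last lra.
  rewrite (max_r (_ : 0 <= N%:R - a)); last lra.
  rewrite (min_l (_ : N%:R + 1 <= b + 1)); last lra.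
  by rewrite le_max => ?; apply/orP; right; rewrite mulr1n; lra.
rewrite addr0; apply: le_trans IHN _.
rewrite ge_max !le_max lexx /= lerD2r le_min !ge_min lexx orbT andbT.
by rewrite lerDl ler01 orbT.
Qed.

Section Lattice.
Variables (R : realType) (d : nat).
Local Notation V := 'rV[R]_d.
Implicit Types (A B : set V) (a b x y : V) (n N : nat).

Lemma lattice_count_box_le a b n o N : (0 < n)%N ->
  (forall i, a ord0 i <= b ord0 i) ->
  lattice_count n o N (box a b)
    <= n%:R ^+ d * \prod_(i < d) (b ord0 i - a ord0 i + n%:R^-1).
Proof.
move=> n0 ab; have n0' : 0 < n%:R :> R by rewrite ltr0n.
(* The product formula for grid sums indexes its factors by [nat]; the default [0] is only taken
   outside ['I_d]. *)
pose F (i : nat) (k : nat) : R := if insub i is Some i' then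
  (n%:R * (a ord0 i' + o) <= k%:R <= n%:R * (b ord0 i' + o))%R%:R else 0.
have -> : lattice_count n o N (box a b) =
    \sum_(s <- grid N d) \prod_(i < d) F i (nth 0%N s i).
  apply: eq_bigr => s _; rewrite indicE /F.
  have E (i : 'I_d) : (a ord0 i <= lattice_pt d n o s ord0 i <= b ord0 i) =
      (n%:R * (a ord0 i + o) <= (nth 0%N s i)%:R <= n%:R * (b ord0 i + o)).
    by rewrite mxE lerBrDr lerBlDr ler_pdivlMr // ler_pdivrMr // !(mulrC _ n%:R).
  have [/set_mem sb|/negP sb] := boolP (_ \in _).
    by rewrite big1 // => i _; rewrite valK -E sb.
  have : ~ forall i, a ord0 i <= lattice_pt d n o s ord0 i <= b ord0 i.
    by move=> sb'; apply: sb; apply/mem_set.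
  by move/existsNP => [i /negP/negbTE]; rewrite E => Fi; rewrite (bigD1 i) //= valK Fi mul0r.
rewrite sum_grid_prod -[in n%:R ^+ d](card_ord d) -prodr_const -big_split /=.
apply: ler_prod => i _; rewrite sumr_ge0 /=; last first.
  by move=> k _; rewrite /F valK ler0n.
rewrite (eq_bigr (fun k : nat => (n%:R * (a ord0 i + o) <= k%:R <= n%:R * (b ord0 i + o))%R%:R));
  last by move=> k _; rewrite /F valK.
apply: le_trans (sum_nat_itv_le _ _) _.
  by rewrite ler_wpDr // ler_pM2l // lerD2r.
by rewrite [leRHS]mulrDr divff ?gt_eqF // lerD2r -mulrBr ler_pM2l //; lra.
Qed.

Lemma box_vol_ge0 a b : 0 <= box_vol a b.
Proof. by apply: prodr_ge0 => i _; rewrite le_max lexx. Qed.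

Lemma vol_ge0 A : (0 <= vol A)%E.
Proof.
apply: le_ereal_inf_tmp => _ [ab _ <-].
by apply: nneseries_ge0 => k _ _; rewrite lee_fin box_vol_ge0.
Qed.


(** A cover by boxes of total volume below [w] is slightly thickened; compactness leaves finitely
    many boxes, each holding at most about [n ^ d] times its volume of lattice points. The threshold
    for [n] is uniform in [o] and [N]. *)
Lemma lattice_count_le_vol A (w : R) : compact A -> (vol A < w%:E)%E ->
  \forall n \near \oo, forall o N, lattice_count n o N A <= w * n%:R ^+ d.
Proof.
move=> cA /ereal_inf_lt[_ [ab /= Aab <-]]; set v := (\sum_(_ <= _ <oo) _)%E => vw.
have v0 : (0 <= v)%E by apply: nneseries_ge0 => k _ _; rewrite lee_fin box_vol_ge0.
have vfin : v \is a fin_num by rewrite ge0_fin_numE // (lt_trans vw) // ltry.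
pose e := w - fine v.
have e0 : 0 < e by rewrite subr_gt0 -lte_fin fineK.
pose c k (i : 'I_d) := Num.max 0 ((ab k).2 ord0 i - (ab k).1 ord0 i).
have c0 k i : 0 <= c k i by rewrite le_max lexx.
have /choice[eta etaP] : forall k : nat, exists z, 0 < z <= 1 /\
    \prod_(i < d) (c k i + z) <= \prod_(i < d) c k i + e / (2 ^ k.+1)%:R.
  move=> k; have [|z] := @exists_prod_addr_le R _ (index_enum 'I_d) _ (e / (2 ^ k.+1)%:R) (c0 k).
    by rewrite divr_gt0 // ltr0n expn_gt0.
  by exists z.
(* Two thirds of [eta k] thicken the box on its two sides; the last third pays for the [1 / n] in
   the lattice count of a box. *)
pose h k : R := eta k / 3.
have h0 k : 0 < h k by rewrite divr_gt0 //; case: (etaP k) => /andP[].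
pose lo k : V := \row_i ((ab k).1 ord0 i - h k).
(* Measuring from the first corner with side [c k i] keeps [lo k] below [hi k] even when the
   original box is empty. *)
pose hi k : V := \row_i ((ab k).1 ord0 i + c k i + h k).
rewrite compact_cover in cA.
have [|x Ax|D _ AD] := cA nat setT
  (fun k => interior (box (lo k) (hi k))).
- by move=> k _; exact: open_interior.
- have [k _ xk] := Aab x Ax; exists k => //=.
  apply/nbhs_ballP; exists (h k) => //= y [_ xy] i.
  have := xy ord0 i; rewrite /ball /= !mxE /c ltr_norml => /andP[].
  have /andP[] := xk i.
  by case: (leP 0 ((ab k).2 ord0 i - (ab k).1 ord0 i)) => ? ? ? ? ?; apply/andP; split; lra.
(* From [n0] on, [1 / n <= h k] for every [k] in [D]; the outer successor keeps [n] positive when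
   [D] is empty. *)
pose n0 := (\max_(k <- D) (Num.truncn (h k)^-1).+1).+1.
exists n0 => // n /= n0n o N.
have n1 : (0 < n)%N by apply: leq_trans n0n.
have nh k : k \in D -> n%:R^-1 <= h k.
  move=> kD; rewrite -[leRHS]invrK lef_pV2 ?posrE ?invr_gt0 ?ltr0n //.
  apply: le_trans (ltW (truncnS_gt _)) _; rewrite ler_nat.
  apply: leq_trans n0n; apply: leq_trans (leqnSn _).
  exact: (@leq_bigmax_seq _ _ _ (fun k => (Num.truncn (h k)^-1).+1)).
have -> : w = fine v + e by rewrite /e addrC subrK.
apply: (@le_trans _ _ (\sum_(k <- D) lattice_count n o N (box (lo k) (hi k)))).
  rewrite exchange_big /=; apply: ler_sum => s _; rewrite indicE.
  have [/set_mem/AD[k /= kD /interior_subset kB]|_] := boolP (_ \in A).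
    rewrite (big_rem k) //= indicE mem_set // lerDl.
    by apply: sumr_ge0 => j _; rewrite indicE ler0n.
  by apply: sumr_ge0 => j _; rewrite indicE ler0n.
apply: (@le_trans _ _ (\sum_(k <- D) n%:R ^+ d * (box_vol (ab k).1 (ab k).2 + e / (2 ^ k.+1)%:R))).
  rewrite big_seq [leRHS]big_seq; apply: ler_sum => k kD.
  apply: le_trans (lattice_count_box_le _ _ _ _) _ => //.
    by move=> i; rewrite !mxE; have := c0 k i; have := h0 k; lra.
  rewrite ler_wpM2l ?exprn_ge0 //; case: (etaP k) => _; apply: le_trans.
  apply: ler_prod => i _; rewrite !mxE; have := nh k kD; have := c0 k i.
  have := h0 k; have : 0 <= n%:R^-1 :> R by rewrite invr_ge0.
  have : eta k = 3 * h k by rewrite /h mulrC divfK.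
  by move=> -> *; apply/andP; split; lra.
rewrite -mulr_sumr mulrC ler_wpM2r ?exprn_ge0 //.
pose F k := box_vol (ab k).1 (ab k).2 + e / (2 ^ k.+1)%:R.
have F0 k : 0 <= F k by rewrite addr_ge0 ?box_vol_ge0 // divr_ge0 // ltW.
pose m := (\max_(k <- D) k).+1.
apply: (@le_trans _ _ (\sum_(0 <= k < m) F k)).
  have -> : \sum_(k <- D) F k = \sum_(0 <= k < m | k \in D) F k.
    rewrite -[RHS]big_filter; apply: perm_big; apply: uniq_perm.
    - exact: fset_uniq.
    - by rewrite filter_uniq // iota_uniq.
    - move=> k; rewrite mem_filter mem_index_iota /=; apply/idP/andP => [kD|[]//].
      by split=> //; rewrite ltnS; exact: (@leq_bigmax_seq _ _ _ id).
  by rewrite [leRHS](bigID (mem D)) /= lerDl sumr_ge0.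
rewrite -lee_fin EFinD fineK //.
have := @epsilon_trick R (fun k => (box_vol (ab k).1 (ab k).2)%:E) e xpredT
  (fun k => box_vol_ge0 _ _) (ltW e0).
apply: le_trans; rewrite -sumEFin.
apply: (@nneseries_lim_ge _ (fun k => (F k)%:E) xpredT 0%N m) => k _ _.
by rewrite lee_fin.
Qed.

(** Rounding the coordinates of a point of [A] down to the lattice lands in [B], so the cubes of
    side [1 / n] with lower corner at a lattice point of [B] cover [A]. *)
Lemma vol_le_lattice_count A B n (o : R) N : (0 < d)%N -> (0 < n)%N ->
  (forall x, A x -> forall i, 0 <= n%:R * (x ord0 i + o) < N%:R) ->
  (forall x y, A x -> (forall i, `|x ord0 i - y ord0 i| <= n%:R^-1) -> B y) ->
  (vol A <= (lattice_count n o N B / n%:R ^+ d)%:E)%E.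
Proof.
move=> d0 n0 AN AB; have n0' : 0 < n%:R :> R by rewrite ltr0n.
pose pt : seq nat -> V := lattice_pt d n o.
pose L := [seq (pt s, pt s + const_mx n%:R^-1) | s <- grid N d & pt s \in B].
(* Past the end of [L] the default box is the single point [0], of volume zero because [d] is
   positive. *)
pose ab k := nth (0, 0) L k.
have [i0 _] : exists i : 'I_d, true by exists (Ordinal d0).
have vol0 k : (size L <= k)%N -> box_vol (ab k).1 (ab k).2 = 0.
  by move=> Lk; rewrite /ab nth_default // /box_vol (bigD1 i0) //= subrr maxxx mul0r.
have cover : A `<=` \bigcup_k box (ab k).1 (ab k).2.
  move=> x Ax; pose s := [seq Num.truncn (n%:R * (x ord0 i + o)) | i <- enum 'I_d].
  have ns (i : 'I_d) : nth 0%N s i = Num.truncn (n%:R * (x ord0 i + o)).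
    by rewrite (nth_map i) ?nth_ord_enum // size_enum_ord.
  have xs (i : 'I_d) : pt s ord0 i <= x ord0 i <= pt s ord0 i + n%:R^-1.
    have /andP[nx0 _] := AN x Ax i.
    have /andP[] := truncn_itv nx0; rewrite -ns -natr1 => le1 /ltW le2.
    rewrite mxE -(ler_pM2l n0') -(ler_pM2l n0' (x ord0 i)) !mulrDr mulrN mulrCA.
    by rewrite divff ?gt_eqF //; apply/andP; split; lra.
  have sG : s \in grid N d.
    rewrite mem_grid size_map size_enum_ord eqxx; apply/allP => _ /mapP[i _ ->].
    have /andP[nx0] := AN x Ax i; rewrite -(ltr_nat R); apply: le_lt_trans.
    by have /andP[] := truncn_itv nx0.
  have sB : pt s \in B.
    apply/mem_set/(AB _ _ Ax) => i; have /andP[] := xs i => *.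
    have nV0 : 0 <= n%:R^-1 :> R by rewrite invr_ge0.
    by rewrite ler_norml; apply/andP; split; lra.
  have sL : (pt s, pt s + const_mx n%:R^-1) \in L by rewrite map_f // mem_filter sB.
  exists (index (pt s, pt s + const_mx n%:R^-1) L) => //.
  by rewrite /ab nth_index //= => i; have := xs i; rewrite !mxE.
apply: (le_trans (ereal_inf_lbound _)); first by exists ab.
rewrite (nneseries_split 0 (size L)); last by move=> k _; rewrite lee_fin box_vol_ge0.
rewrite eseries0 ?adde0; last by move=> k Lk _; rewrite vol0.
rewrite add0n sumEFin lee_fin.
have -> : \sum_(0 <= k < size L) box_vol (ab k).1 (ab k).2 = \sum_(l <- L) box_vol l.1 l.2.
  by rewrite (big_nth (0, 0)).
rewrite big_map big_filter /lattice_count mulr_suml big_mkcond /=.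
apply: ler_sum => s _; rewrite indicE; case: ifP => _; rewrite ?mul0r // mul1r.
rewrite /box_vol -exprVn (eq_bigr (fun=> n%:R^-1)) ?prodr_const ?card_ord //.
by move=> i _; rewrite !mxE addrAC subrr add0r max_r // invr_ge0.
Qed.

Lemma vol_homothety_le A (c : V) (t : R) : 0 < t ->
  (vol [set (c + t *: y)%R | y in A] <= (t ^+ d)%:E * vol A)%E.
Proof.
move=> t0; have td : 0 < t ^+ d by rewrite exprn_gt0.
rewrite -lee_pdivrMl //; apply: le_ereal_inf_tmp => _ [ab /= Aab <-].
rewrite lee_pdivrMl // -nneseriesZl; last by move=> k _; rewrite lee_fin box_vol_ge0.
apply: ereal_inf_lbound; exists (fun k => (c + t *: (ab k).1, c + t *: (ab k).2)).
  move=> _ [y /Aab[k _ yk] <-]; exists k => // i /=; rewrite !mxE !lerD2l !ler_pM2l //.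
apply: eq_eseriesr => k _; rewrite -EFinM; congr EFin.
rewrite /box_vol -[in t ^+ d](card_ord d) -prodr_const -big_split /=.
apply: eq_bigr => i _; rewrite !mxE maxr_pMr ?ltW // mulr0; congr Num.max.
by ring.
Qed.

Lemma bounded_set_coord A : bounded_set A ->
  exists M : R, forall x, A x -> forall i, `|x ord0 i| <= M.
Proof.
move=> [M [_ AM]]; exists (M + 1) => x Ax i.
apply: le_trans (AM (M + 1) _ x Ax); last by rewrite ltrDl.
rewrite [leRHS]/Num.norm /= mx_normrE.
exact: (le_bigmax _ (fun ij => `|x ij.1 ij.2|) (ord0, i)).
Qed.

Lemma vol_bounded_lty A : (0 < d)%N -> bounded_set A -> (vol A < +oo)%E.
Proof.
move=> d0 /bounded_set_coord[M AM].
apply: (@le_lt_trans _ _ (box_vol (const_mx (- M) : V) (const_mx M))%:E); last exact: ltry.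
pose ab (k : nat) : V * V := if k is 0%N then (const_mx (- M), const_mx M) else (0, 0).
have Aab : A `<=` \bigcup_k box (ab k).1 (ab k).2.
  by move=> x /AM xM; exists 0%N => //= i; rewrite !mxE -ler_norml.
apply: (le_trans (ereal_inf_lbound _)); first by exists ab.
rewrite (nneseries_split 0 1); last by move=> k _; rewrite lee_fin box_vol_ge0.
rewrite eseries0 ?adde0 ?big_nat1 // => -[//|k] _ _ /=.
by rewrite /box_vol (bigD1 (Ordinal d0)) //= subrr maxxx mul0r.
Qed.

End Lattice.

(** * Symmetric convex bodies *)

(** An independent set of maximum size works: adding a [c] related to none of its members, or
    replacing [s] by unrelated [c1] and [c2], would produce a larger one. *)
Lemma exists_exchange_maximal_independent (T : choiceType) (X : {fset T}) (e : rel T) :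
  (forall a, a \in X -> e a a) -> (forall a b, e a b = e b a) ->
  exists S : {fset T},
    [/\ (S `<=` X)%fset,
        forall a b, a \in S -> b \in S -> e a b -> a = b,
        forall c, c \in X -> exists2 s, s \in S & e c s &
        forall s c1 c2, s \in S -> c1 \in X -> c2 \in X ->
          (forall s', s' \in S -> e c1 s' -> s' = s) ->
          (forall s', s' \in S -> e c2 s' -> s' = s) -> e c1 c2].
Proof.
move=> e_refl e_sym.
pose indep (S : {fset T}) := forall a b, a \in S -> b \in S -> e a b -> a = b.
pose P k := `[< exists S : {fset T}, [/\ (S `<=` X)%fset, indep S & #|` S| = k] >].
have P0 : exists k, P k.
  exists 0%N; apply/asboolP; exists fset0; split=> //; exact: fsub0set.
have Pub k : P k -> (k <= #|` X|)%N.
  by move=> /asboolP[S [SX _ <-]]; exact: fsubset_leq_card.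
have [k /asboolP[S [SX indS Sk]] kmax] := ex_maxnP P0 Pub.
have maxS (S' : {fset T}) : (S' `<=` X)%fset -> indep S' -> (#|` S'| <= #|` S|)%N.
  by move=> S'X indS'; rewrite Sk; apply: kmax; apply/asboolP; exists S'.
have indU (S' : {fset T}) c : indep S' -> (forall s, s \in S' -> ~~ e c s) ->
    indep (c |` S')%fset.
  move=> indS' cS' a b /fset1UP[->|aS] /fset1UP[->|bS] //.
  - by move=> ecb; have := cS' b bS; rewrite ecb.
  - by rewrite e_sym => eca; have := cS' a aS; rewrite eca.
  - exact: indS'.
have notin (S' : {fset T}) c : c \in X -> (forall s, s \in S' -> ~~ e c s) -> c \notin S'.
  by move=> cX cS'; apply/negP => /cS'; rewrite e_refl.
exists S; split=> //.
- move=> c cX; apply: contrapT => nS.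
  have cS s : s \in S -> ~~ e c s by move=> sS; apply/negP => ecs; apply: nS; exists s.
  have := maxS (c |` S)%fset _ (indU _ _ indS cS).
  rewrite cardfsU1 notin // ltnn => /(_ _)/wrap[]//.
  by rewrite fsubUset fsub1set cX.
- move=> s c1 c2 sS c1X c2X priv1 priv2; apply: contrapT => /negP ne12.
  have c2S u : u \in (S `\ s)%fset -> ~~ e c2 u.
    by rewrite in_fsetD1 => /andP[us uS]; apply: contraNN us => /priv2 ->.
  have c1S u : u \in (c2 |` (S `\ s))%fset -> ~~ e c1 u.
    move=> /fset1UP[->//|]; rewrite in_fsetD1 => /andP[us uS].
    by apply: contraNN us => /priv1 ->.
  have indD : indep (S `\ s)%fset.
    by move=> a b; rewrite !in_fsetD1 => /andP[_ aS] /andP[_ bS]; exact: indS.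
  have := maxS (c1 |` (c2 |` (S `\ s)))%fset _ (indU _ _ (indU _ _ indD c2S) c1S).
  rewrite !cardfsU1 !notin // (cardfsD1 s S) sS !add1n ltnn => /(_ _)/wrap[]//.
  rewrite !fsubUset !fsub1set c1X c2X /=; apply: fsubset_trans SX.
  exact: fsubD1set.
Qed.

(** For a symmetric convex body and [t >= 0], [dilate K t x] says that the norm with unit ball [K]
    is at most [t] at [x]; [dilateN] and [dilateD] are its symmetry and triangle inequality. *)
Definition dilate (R : realType) (d : nat) (K : set 'rV[R]_d) (t : R) : set 'rV[R]_d :=
  [set t *: y | y in K].

Definition homothet (R : realType) (d : nat) (K : set 'rV[R]_d) (c : 'rV[R]_d) (t : R) :
  set 'rV[R]_d := [set c + t *: y | y in K].

Lemma homothetP (R : realType) (d : nat) (K : set 'rV[R]_d) (c : 'rV[R]_d) (t : R) x :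
  homothet K c t x <-> dilate K t (x - c).
Proof.
split=> -[y Ky xy]; exists y => //; first by rewrite -xy addrAC subrr add0r.
by rewrite xy addrC subrK.
Qed.

Lemma homothet1 (R : realType) (d : nat) (K : set 'rV[R]_d) (c : 'rV[R]_d) :
  homothet K c 1 = translate K c.
Proof.
by apply/seteqP; split=> _ [y Ky <-]; exists y => //; rewrite scale1r addrC.
Qed.

Lemma compact_homothet (R : realType) (d : nat) (K : set 'rV[R]_d) (c : 'rV[R]_d) (t : R) :
  compact K -> compact (homothet K c t).
Proof.
move=> cK; apply: continuous_compact => //; apply: continuous_subspaceT => y.
by apply: continuousD; [exact: cst_continuous|exact: scaler_continuous].
Qed.

Section SymmetricConvex.
Variables (R : realType) (d : nat) (K : set 'rV[R]_d).
Hypotheses (bodyK : convex_body K) (symK : symmetric_set K).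
Local Notation V := 'rV[R]_d.
Implicit Types (a b t : R) (x y : V).

Lemma dilateN a x : dilate K a x -> dilate K a (- x).
Proof.
by move=> [y Ky <-]; exists (- y); [rewrite symK; exists y|rewrite scalerN].
Qed.

Lemma convex_body_comb a b x y : 0 <= a -> 0 <= b -> a + b = 1 ->
  K x -> K y -> K (a *: x + b *: y).
Proof.
move=> a0 b0 ab Kx Ky; have [_ cK _] := bodyK.
have a1 : a <= 1 by lra.
have -> : b = 1 - a by lra.
exact: set_mem (cK x y (Itv01 a0 a1) (mem_set Kx) (mem_set Ky)).
Qed.

Lemma dilateD a b x y : 0 <= a -> 0 <= b ->
  dilate K a x -> dilate K b y -> dilate K (a + b) (x + y).
Proof.
move=> a0 b0 [u Ku <-] [v Kv <-]; have [ab0|abn0] := eqVneq (a + b) 0.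
  have -> : a = 0 by lra.
  have -> : b = 0 by lra.
  by exists u => //; rewrite addr0 !scale0r addr0.
have ab0 : 0 < a + b by rewrite lt_def abn0 addr_ge0.
exists ((a / (a + b)) *: u + (b / (a + b)) *: v).
  by apply: convex_body_comb => //; [exact/divr_ge0/ltW|exact/divr_ge0/ltW|rewrite -mulrDl divff].
by rewrite scalerDr !scalerA !(mulrC (a + b)) !divfK.
Qed.

(** A cube around an interior point [c] lies in [K], and by symmetry so does one around [- c];
    averaging the two gives a cube around [0]. *)
Lemma exists_cube_subset : exists2 r, 0 < r & forall x, (forall i, `|x ord0 i| <= r) -> K x.
Proof.
have [_ _ [c /nbhs_ballP[e /= e0 ceK]]] := bodyK.
have Kc x : (forall i, `|x ord0 i| <= e / 2) -> K (c + x).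
  move=> xe; apply: ceK; split=> // i j; rewrite ord1 /ball /= !mxE opprD addrA subrr sub0r normrN.
  by apply: le_lt_trans (xe j) _; rewrite ltr_pdivrMr // ltr_pMr // ltr1n.
exists (e / 2) => [|x xe]; first exact: divr_gt0.
have -> : x = 2^-1 *: (c + x) + 2^-1 *: (- (c - x)).
  by apply/rowP => i; rewrite !mxE; field.
apply: convex_body_comb; rewrite ?invr_ge0 //; first by field.
  exact: Kc.
rewrite symK; exists (c - x) => //; apply: Kc => i; rewrite mxE normrN; exact: xe.
Qed.

Lemma dilate0 t : 0 <= t -> dilate K t 0.
Proof.
move=> t0; have [r r0 Kr] := exists_cube_subset; exists 0; rewrite ?scaler0 //.
by apply: Kr => i; rewrite mxE normr0 ltW.
Qed.

Lemma dilate_le a b x : 0 <= a <= b -> dilate K a x -> dilate K b x.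
Proof.
move=> /andP[a0 ab] ax; rewrite -[b](subrK a) -[x]add0r.
by apply: dilateD => //; rewrite ?subr_ge0 //; apply: dilate0; rewrite subr_ge0.
Qed.

(** Lets a small dilate of [K] absorb the error of rounding to the lattice. *)
Lemma near_cube_dilate e : 0 < e ->
  \forall n \near \oo, forall x, (forall i, `|x ord0 i| <= n%:R^-1) -> dilate K e x.
Proof.
move=> e0; have [r r0 Kr] := exists_cube_subset.
have er0 : 0 < e * r by rewrite mulr_gt0.
exists (Num.truncn (e * r)^-1).+1 => // n /= en x xn.
exists (e^-1 *: x); last by rewrite scalerA divff ?gt_eqF // scale1r.
apply: Kr => i; rewrite mxE normrM gtr0_norm ?invr_gt0 // mulrC ler_pdivrMr //.
apply: le_trans (xn i) _; rewrite mulrC -[leRHS]invrK lef_pV2 ?posrE ?invr_gt0 //.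
  by apply: le_trans (ltW (truncnS_gt _)) _; rewrite ler_nat.
by rewrite ltr0n (leq_trans _ en).
Qed.

Lemma translate_meet_dilate (c1 c2 : V) :
  translate K c1 `&` translate K c2 !=set0 -> dilate K 2 (c1 - c2).
Proof.
move=> [_ [[x Kx <-] [y Ky xy]]]; have -> : c1 - c2 = y + - x.
  by apply/rowP => i; have /rowP/(_ i) := xy; rewrite !mxE; lra.
have -> : 2 = 1 + 1 :> R by [].
apply: dilateD => //; first by exists y; rewrite ?scale1r.
by apply: dilateN; exists x; rewrite ?scale1r.
Qed.

End SymmetricConvex.

(* Discrete Brunn-Minkowski inequality for [A] and [- A]. Reversing the grid,
   [k |-> N.-1 - k], stands for negation, whence the offset [N.-1 / n]. *)
Lemma lattice_count_difference (R : realType) (d n : nat) (o : R) (N : nat)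
    (A B : set 'rV[R]_d) : (0 < n)%N ->
  (forall x y z, A x -> A y -> (forall i, `|(z - (x - y)) ord0 i| <= n%:R^-1) -> B z) ->
  2 ^+ d * lattice_count n o N A <= lattice_count n (N.-1%:R / n%:R) N.*2 B.
Proof.
move=> n0 AB; have n0' : 0 < n%:R :> R by rewrite ltr0n.
pose pt : seq nat -> 'rV[R]_d := lattice_pt d n o.
pose rv (s : seq nat) := [seq N.-1 - i | i <- s]%N.
have := @discrete_prekopa_leindler R N d (fun s => \1_A (pt s)) (fun s => \1_A (pt (rv s)))
  (fun s => \1_B (lattice_pt d n (N.-1%:R / n%:R) s)).
rewrite (sum_grid_rev _ _ (fun s => \1_A (pt s))) => /(_ _ _ _ _)/wrap[s|s|s|x y w xG yG xyw|].
- by rewrite indicE.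
- by rewrite indicE.
- by rewrite indicE.
- rewrite !indicE; have [/set_mem Ax|_] := boolP (pt x \in A); last by rewrite mul0r sqr_ge0.
  have [/set_mem Ay|_] := boolP (pt (rv y) \in A); last by rewrite mulr0 sqr_ge0.
  rewrite mem_set ?mulr1 ?expr1n //; apply: (AB _ _ _ Ax Ay) => i.
  move: yG; rewrite mem_grid => /andP[/eqP sy /allP yN].
  have iy : (i < size y)%N by rewrite sy.
  have yiN : (nth 0 y i < N)%N by apply: yN; rewrite mem_nth.
  rewrite !mxE (nth_map 0%N) // natrB; last by lia.
  have /andP[] := near_sum_nth i xyw; rewrite -(ler_nat R) -[X in _ -> is_true X -> _](ler_nat R).
  rewrite -natr1 natrD => le1 le2.
  set X := (nth 0 x i)%:R in le1 le2 *; set Y := (nth 0 y i)%:R in le1 le2 *.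
  set W := (nth 0 w i)%:R in le1 le2 *.
  (* The offsets cancel, leaving the slack of [near_sum], at most one, divided by [n]. *)
  rewrite [X in `|X|](_ : _ = (W - (X + Y)) / n%:R); last by field; rewrite gt_eqF.
  rewrite ger0_norm ?divr_ge0 ?subr_ge0 // ler_pdivrMr // mulVf ?gt_eqF //; lra.
rewrite -/(lattice_count n o N A) -/(lattice_count _ _ _ B).
set a := lattice_count _ _ _ A; set b := lattice_count _ _ _ B => ab.
have a0 : 0 <= a by apply: sumr_ge0 => s _; rewrite indicE.
have b0 : 0 <= b by apply: sumr_ge0 => s _; rewrite indicE.
(* Squares are compared: the reversed indicator has the same sum [a], so [ab] bounds
   [4 ^+ d * (a * a)]. *)
rewrite -(@ler_pXn2r _ 2) ?nnegrE ?mulr_ge0 ?exprn_ge0 //.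
apply: le_trans ab; rewrite exprMn -exprM mulnC exprM (_ : 2 ^+ 2 = 4); last by ring.
by rewrite expr2.
Qed.

(** * Counting lattice points of a packing *)

Section Packing.
Variables (R : realType) (d : nat) (K : set 'rV[R]_d).
Hypotheses (d0 : (0 < d)%N) (bodyK : convex_body K) (symK : symmetric_set K).
Local Notation V := 'rV[R]_d.
Variables (X S : {fset set V}) (ctr : set V -> V).
Hypothesis XK : forall A, A \in X -> translate K (ctr A) = A.
Hypothesis SX : (S `<=` X)%fset.

(** The offset [M] moves [[-M, M]] to [[0, 2 M]], and the grid size covers this interval scaled by
    [n]. *)
Lemma vol_le_lattice_count_bounded (A B : set V) (n : nat) (M : R) : (0 < n)%N ->
  (forall x, A x -> forall i, `|x ord0 i| <= M) ->
  (forall x y, A x -> (forall i, `|(x - y) ord0 i| <= n%:R^-1) -> B y) ->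
  (vol A <= (lattice_count n M (Num.truncn (n%:R * (M + M))).+1 B / n%:R ^+ d)%:E)%E.
Proof.
move=> n0 AM AB; apply: vol_le_lattice_count => // [x Ax i|x y Ax xy]; last first.
  by apply: AB Ax _ => i; rewrite !mxE.
have := AM x Ax i; rewrite ler_norml => /andP[Mx xM].
rewrite mulr_ge0 //=; last by lra.
by apply: le_lt_trans (truncnS_gt _); rewrite ler_wpM2l // lerD2r.
Qed.

Lemma near_lattice_count_homothet (c : V) (t v w : R) : vol K = v%:E -> 0 < t -> v < w ->
  \forall n \near \oo, forall o N,
    lattice_count n o N (homothet K c t) <= t ^+ d * w * n%:R ^+ d.
Proof.
move=> Kv t0 vw; apply: lattice_count_le_vol.
  by apply: compact_homothet; case: bodyK.
apply: le_lt_trans (vol_homothety_le _ _ t0) _.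
by rewrite Kv -EFinM lte_fin ltr_pM2l // exprn_gt0.
Qed.

Lemma compact_bigcup_translates (Y : {fset set V}) : (Y `<=` X)%fset ->
  compact (\bigcup_(A in [set` Y]) A).
Proof.
move=> /fsubsetP YX; rewrite bigcup_fset big_seq_cond.
elim/big_ind : _ => [||A]; [exact: compact0|exact: compactU|].
rewrite andbT => /YX/XK <-; rewrite -homothet1; apply: compact_homothet.
by case: bodyK.
Qed.

(** [vol] is an outer measure; additivity over the disjoint members of [S] comes from lattice
    counts. Each count is bounded below through a copy of the member shrunk by [t], which leaves a
    margin for rounding. *)
Lemma card_vol_le (v : R) : vol K = v%:E ->
  (forall A B, A \in S -> B \in S -> A `&` B !=set0 -> A = B) ->
  ((#|` S|%:R * v)%:E <= vol (\bigcup_(A in [set` S]) A))%E.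
Proof.
move=> Kv disjS; set U := \bigcup_(_ in _) _.
have cU : compact U by exact: compact_bigcup_translates.
have /bounded_set_coord[M UM] := compact_bounded cU.
have Ufin : vol U \is a fin_num.
  by rewrite ge0_fin_numE ?vol_ge0 // vol_bounded_lty //; exact: compact_bounded.
rewrite -(fineK Ufin) lee_fin; set u := fine _.
apply/ler_addgt0Pr => e e0; set w := u + e.
have w0 : 0 < w by rewrite ltr_wpDl // fine_ge0 // vol_ge0.
have Uw : (vol U < w%:E)%E by rewrite -(fineK Ufin) lte_fin ltrDl.
apply: (@le_of_le_exprn_mul _ _ _ d (ltW w0)) => t t1.
have t0 : 0 < t by rewrite (lt_trans ltr01).
have tV1 : 0 < 1 - t^-1 by rewrite subr_gt0 invf_lt1.
have tV0 : 0 < t^-1 by rewrite invr_gt0.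
near \oo => n.
have n0 : (0 < n)%N by near: n; exact: nbhs_infty_gt.
have cube : forall x : V, (forall i, `|x ord0 i| <= n%:R^-1) -> dilate K (1 - t^-1) x.
  by near: n; exact: near_cube_dilate.
have countU : forall o N, lattice_count n o N U <= w * n%:R ^+ d.
  by near: n; exact: lattice_count_le_vol.
have n0' : 0 < n%:R ^+ d :> R by rewrite exprn_gt0 // ltr0n.
set N := (Num.truncn (n%:R * (M + M))).+1.
have Kle A : A \in S -> v <= t ^+ d * (lattice_count n M N A / n%:R ^+ d).
  move=> AS; have AX : A \in X by move/fsubsetP : SX; apply.
  have shrink x : homothet K (ctr A) t^-1 x -> A x.
    move=> /homothetP Ax; rewrite -(XK AX) -homothet1; apply/homothetP.
    by apply: dilate_le Ax => //; rewrite ltW //=; lra.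
  rewrite -lee_fin -Kv EFinM.
  (* [K] is a translate of the shrunken copy enlarged by [t]; rounding points of that copy stays
     inside [A]. *)
  have -> : K = [set (- t *: ctr A) + t *: y | y in homothet K (ctr A) t^-1].
    apply/seteqP; split=> [x Kx|_ [_ [x Kx <-] <-]].
      exists (ctr A + t^-1 *: x); first by exists x.
      by rewrite scalerDr addrA scaleNr addNr add0r scalerA divff ?gt_eqF // scale1r.
    by rewrite scalerDr addrA scaleNr addNr add0r scalerA divff ?gt_eqF // scale1r.
  apply: le_trans (vol_homothety_le _ _ t0) _.
  rewrite lee_pmul2l ?lte_fin ?exprn_gt0 //.
  apply: vol_le_lattice_count_bounded => // [x /shrink Ax i|x y /homothetP Ax xy].
    by apply: UM; exists A.
  rewrite -(XK AX) -homothet1; apply/homothetP.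
  have -> : y - ctr A = (x - ctr A) + - (x - y) by apply/rowP => i; rewrite !mxE; ring.
  have -> : 1 = t^-1 + (1 - t^-1) by rewrite addrC subrK.
  by apply: dilateD => //; [exact: ltW|exact: ltW|apply: dilateN => //; exact: cube].
(* Each lattice point lies in at most one member of [S]. *)
have sumU : \sum_(A <- S) lattice_count n M N A <= lattice_count n M N U.
  rewrite exchange_big; apply: ler_sum => s _; rewrite indicE.
  set p := lattice_pt _ _ _ _.
  have [/set_mem[A /= AS pA]|pU] := boolP (p \in U).
    rewrite (big_fsetD1 A) //= big_seq big1; first by rewrite addr0 indicE ler_nat leq_b1.
    move=> B; rewrite in_fsetD1 => /andP[BA BS]; rewrite indicE.
    case: (boolP (p \in B)) => // /set_mem pB.
    by case/eqP: BA; apply: disjS => //; exists p.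
  rewrite big_seq big1 // => A AS; rewrite indicE.
  case: (boolP (p \in A)) => // /set_mem pA.
  by case/negP: pU; apply/mem_set; exists A.
have -> : #|` S|%:R * v = \sum_(A <- S) v.
  by rewrite big_const_seq count_predT iter_addr_0 mulr_natl.
apply: (@le_trans _ _ (\sum_(A <- S) t ^+ d * (lattice_count n M N A / n%:R ^+ d))).
  by rewrite big_seq [leRHS]big_seq; exact: ler_sum.
rewrite -mulr_sumr ler_pM2l ?exprn_gt0 // -mulr_suml ler_pdivrMr //.
exact: le_trans sumU _.
Unshelve. all: by end_near. Qed.

(** The double count is carried out on indicators at lattice points; only the union and homothets of
    [K] are compared with volumes. *)
Lemma vol_le_card (v : R) : vol K = v%:E ->
  (forall A, A \in X -> exists2 s, s \in S & A `&` s !=set0) ->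
  (forall s A B, s \in S -> A \in X -> B \in X ->
     (forall s', s' \in S -> A `&` s' !=set0 -> s' = s) ->
     (forall s', s' \in S -> B `&` s' !=set0 -> s' = s) -> A `&` B !=set0) ->
  (vol (\bigcup_(A in [set` X]) A) <= ((3 ^+ d + 2 ^+ d) / 2 * (#|` S|%:R * v))%:E)%E.
Proof.
move=> Kv hitS privS; set U := \bigcup_(_ in _) _.
have v0 : 0 <= v by rewrite -lee_fin -Kv vol_ge0.
have cU : compact U by exact: compact_bigcup_translates.
have /bounded_set_coord[M UM] := compact_bounded cU.
have Ufin : vol U \is a fin_num.
  by rewrite ge0_fin_numE ?vol_ge0 // vol_bounded_lty //; exact: compact_bounded.
rewrite -(fineK Ufin) lee_fin; set u := fine _.
set c := (3 ^+ d + 2 ^+ d) / 2; have c0 : 0 <= c by rewrite divr_ge0 // addr_ge0 // exprn_ge0.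
(* Counts are controlled only by numbers strictly above the volume of [K]; letting [w] decrease to
   [v] gives the claim. *)
suff main w : v < w -> u <= c * (#|` S|%:R * w).
  apply/ler_addgt0Pr => e e0.
  have k0 : 0 < c * #|` S|%:R + 1 by rewrite ltr_wpDl // mulr_ge0.
  have /main/le_trans : v < v + e / (c * #|` S|%:R + 1) by rewrite ltrDl divr_gt0.
  apply; rewrite mulrDr mulrDr lerD2l mulrA mulrCA -[leRHS]mulr1 ler_pM2l //.
  by rewrite ler_pdivrMr // mul1r lerDl.
move=> vw; have w0 : 0 < w by exact: le_lt_trans vw.
have b0 : 0 <= c * (#|` S|%:R * w) by rewrite mulr_ge0 // mulr_ge0 // ltW.
apply: (@le_of_le_exprn_mul _ _ _ d b0) => t t1.
have t0 : 0 < t by rewrite (lt_trans ltr01).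
have t10 : 0 < t - 1 by rewrite subr_gt0.
(* A translate meeting [s] has its centre within [2] of that of [s], and [t + 2 <= 3 * t]. *)
pose Q s := homothet K (ctr s) (3 * t).
(* The private part of [s], inflated by [t]: it uses the translates that meet no other member of
   [S]. *)
pose P s : set V := [set x | exists A, [/\ A \in X,
  forall s', s' \in S -> A `&` s' !=set0 -> s' = s & dilate K t (x - ctr A)]].
(* The inflated union, which for large [n] contains the roundings of all points of [U]. *)
pose U' : set V := [set x | exists2 A, A \in X & dilate K t (x - ctr A)].
have meet A B : A \in X -> B \in X -> A `&` B !=set0 -> dilate K 2 (ctr A - ctr B).
  by move=> /XK AK /XK BK; rewrite -{1}AK -{1}BK; exact: translate_meet_dilate.
have SXm s : s \in S -> s \in X by move/fsubsetP : SX; apply.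
(* If [A] meets a second member [s'], then [Q s] and [Q s'] both contain [p]; otherwise [Q s] and
   [P s] do. *)
have pointwise p : 2 * \1_U' p <= \sum_(s <- S) (\1_(Q s) p + \1_(P s) p) :> R.
  have pos s : 0 <= \1_(Q s) p + \1_(P s) p :> R by rewrite !indicE addr_ge0.
  rewrite [in leLHS]indicE; have [/set_mem[A AX pA]|_] := boolP (p \in U'); last first.
    by rewrite mulr0 sumr_ge0.
  have inQ s : s \in S -> A `&` s !=set0 -> \1_(Q s) p = 1 :> R.
    move=> sS As; rewrite indicE mem_set //; apply/homothetP.
    have -> : p - ctr s = (p - ctr A) + (ctr A - ctr s) by rewrite addrA subrK.
    apply: (@dilate_le _ _ _ bodyK symK (t + 2)); first by lra.
    by apply: dilateD => //; [exact: ltW|apply: meet => //; exact: SXm].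
  have [s sS As] := hitS A AX; rewrite (big_fsetD1 s) //= (inQ s) //.
  have [[s' [s'S As' ss']]|nex] := pselect (exists s', [/\ s' \in S, A `&` s' !=set0 & s' != s]).
    rewrite (big_fsetD1 s') ?in_fsetD1 ?ss' //= (inQ s') // !indicE.
    set Z := \sum_(_ <- _) _; have : 0 <= Z by exact: sumr_ge0.
    have := ler0n R (p \in P s); have := ler0n R (p \in P s').
    lra.
  have -> : \1_(P s) p = 1 :> R.
    rewrite indicE mem_set //; exists A; split=> // s' s'S As'.
    by apply/eqP; apply: contra_notT nex => ss'; exists s'.
  rewrite mulr1 lerDl; exact: sumr_ge0.
near \oo => n.
have n0 : (0 < n)%N by near: n; exact: nbhs_infty_gt.
have n0' : 0 < n%:R ^+ d :> R by rewrite exprn_gt0 // ltr0n.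
have cube : forall x : V, (forall i, `|x ord0 i| <= n%:R^-1) -> dilate K (t - 1) x.
  by near: n; exact: near_cube_dilate.
have countH : forall o N,
    lattice_count n o N (homothet K 0 (4 * t)) <= (4 * t) ^+ d * w * n%:R ^+ d.
  by near: n; apply: near_lattice_count_homothet Kv _ vw; rewrite mulr_gt0.
have countQ : forall s, s \in S ->
    forall o N, lattice_count n o N (Q s) <= (3 * t) ^+ d * w * n%:R ^+ d.
  near: n.
  have : nbhs \oo (\bigcap_(s in [set` S]) [set n | forall o N,
      lattice_count n o N (Q s) <= (3 * t) ^+ d * w * n%:R ^+ d]).
    apply: filter_bigI => s _; apply: near_lattice_count_homothet Kv _ vw.
    by rewrite mulr_gt0.
  by apply: filterS => n nQ s sS; exact: nQ.
have countP s o N : s \in S -> lattice_count n o N (P s) <= (2 * t) ^+ d * w * n%:R ^+ d.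
  (* Since [(4 t)^d = 2^d (2 t)^d], it suffices to place the rounded difference set of [P s] inside
     [4 t K]. *)
  move=> sS; rewrite -(@ler_pM2l _ (2 ^+ d)) ?exprn_gt0 // !mulrA -exprMn mulrA -natrM.
  apply: le_trans (countH (N.-1%:R / n%:R) N.*2).
  apply: lattice_count_difference => // x y z [A [AX As xA]] [B [BX Bs yB]] xyz.
  apply/homothetP; rewrite subr0.
  have -> : z = (z - (x - y)) + ((x - ctr A) + - (y - ctr B) + (ctr A - ctr B)).
    by apply/rowP => i; rewrite !mxE; ring.
  (* Rounding costs [t - 1], the two inflated bodies [t] each, and the centres of two meeting
     translates [2]: in all [3 t + 1 <= 4 t]. *)
  apply: (@dilate_le _ _ _ bodyK symK ((t - 1) + ((t + t) + 2))); first by lra.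
  apply: dilateD => //; [lra|lra|exact: cube|].
  apply: dilateD => //; [lra| |by apply: meet => //; exact: privS Bs].
  by apply: dilateD => //; [lra|lra|exact: dilateN].
set N := (Num.truncn (n%:R * (M + M))).+1.
have Ule : u <= lattice_count n M N U' / n%:R ^+ d.
  rewrite -lee_fin fineK //; apply: vol_le_lattice_count_bounded => // x y [A /= AX Ax] xy.
  exists A => //; rewrite -(XK AX) -homothet1 in Ax; move/homothetP: Ax => Ax.
  have -> : y - ctr A = (x - ctr A) + - (x - y) by apply/rowP => i; rewrite !mxE; ring.
  have -> : t = 1 + (t - 1) by rewrite addrC subrK.
  by apply: dilateD => //; [exact: ltW|apply: dilateN => //; exact: cube].
apply: le_trans Ule _; rewrite ler_pdivrMr //.
have : 2 * lattice_count n M N U' <= \sum_(s <- S) ((3 * t) ^+ d + (2 * t) ^+ d) * w * n%:R ^+ d.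
  apply: (@le_trans _ _ (\sum_(s <- S) (lattice_count n M N (Q s) + lattice_count n M N (P s)))).
    rewrite mulr_sumr; under [leRHS]eq_bigr do rewrite -big_split.
    by rewrite exchange_big; apply: ler_sum => s _; exact: pointwise.
  rewrite big_seq [leRHS]big_seq; apply: ler_sum => s sS.
  by rewrite 2!mulrDl; apply: lerD; [exact: countQ|exact: countP].
rewrite big_const_seq count_predT iter_addr_0 !exprMn -[X in _ <= X]mulr_natr.
rewrite /c; set k := #|` S|%:R; set q := n%:R ^+ d; set a := lattice_count _ _ _ _.
by move=> ?; lra.
Unshelve. all: by end_near. Qed.

End Packing.

(** * The bound for finite collections of translates *)

Theorem theorem1p4 (R : realType) (d : nat) (hd : (1 <= d)%N)
    (K : set 'rV[R]_d) (hK : convex_body K) (hsym : symmetric_set K) :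
  ((2 / (3 ^+ d + 2 ^+ d))%:E <= fconst K)%E /\
  (forall C : set (set 'rV[R]_d), finite_translates K C ->
     exists2 S : set (set 'rV[R]_d), disjoint_subcollection S C &
       ((2 / (3 ^+ d + 2 ^+ d))%:E * vol (\bigcup_(A in C) A)
          <= vol (\bigcup_(A in S) A))%E).
Proof.
set c := 2 / _.
have k0 : 0 < 3 ^+ d + 2 ^+ d :> R by rewrite addr_gt0 // exprn_gt0.
have c0 : 0 < c by rewrite divr_gt0.
(* The second claim makes [c] admissible, and [fconst K] is the supremum of the admissible
   constants. *)
suff main (C : set (set 'rV[R]_d)) : finite_translates K C ->
    exists2 S, disjoint_subcollection S C &
      (c%:E * vol (\bigcup_(A in C) A) <= vol (\bigcup_(A in S) A))%E.
  split=> //; apply: ereal_sup_ubound; exists c => //; split=> //; exact: ltW.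
move=> [/finite_fsetP[X ->] CK].
have /choice[ctr ctrE] : forall A, exists x, A \in X -> translate K x = A.
  move=> A; case: (boolP (A \in X)) => [/CK[x _ <-]|_]; first by exists x.
  by exists 0.
pose meets := fun A B : set 'rV[R]_d => `[< A `&` B !=set0 >].
have [y Ky] : K !=set0 by case: hK => _ _ [y /interior_subset Ky]; exists y.
have [||S [SX disjS hitS privS]] := @exists_exchange_maximal_independent _ X meets.
- move=> A AX; apply/asboolP; rewrite setIid -(ctrE A AX).
  by exists (y + ctr A); exists y.
- by move=> A B; rewrite /meets setIC.
have Kfin : vol K \is a fin_num.
  by rewrite ge0_fin_numE ?vol_ge0 // vol_bounded_lty //; apply: compact_bounded; case: hK.
have Kv : vol K = (fine (vol K))%:E by rewrite fineK.
exists [set` S].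
  split; first by move=> A /= AS; move/fsubsetP : SX; apply.
  by move=> A B AS BS AB; apply: disjS => //; apply/asboolP.
(* Both volumes are compared with the cardinality of [S] times the volume of [K]. *)
apply: (@le_trans _ _ (#|` S|%:R * fine (vol K))%:E); last first.
  by apply: (card_vol_le hd hK hsym ctrE SX Kv) => A B AS BS AB; apply: disjS => //; apply/asboolP.
rewrite -lee_pdivlMl // -EFinM invf_div.
apply: (vol_le_card hd hK hsym ctrE SX Kv).
  by move=> A /hitS[s sS /asboolP As]; exists s.
move=> s A B sS AX BX As Bs; apply/asboolP; apply: (privS s) => //.
  by move=> s' s'S /asboolP; exact: As.
by move=> s' s'S /asboolP; exact: Bs.
Qed.
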